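(* Suppose $d\ge2$, $H\ge3$ and $K\ge\max\{(d-1)^2H/2,\;H^3(d-1)^2/32\}$. Then for any algorithm $\mathfrak A$ there exists an MDP $M_\theta$ of the family below such that $L_\theta\le3/2$, $L_\varphi\le1+\log(H-1)$, and $\mathbb E[\mathrm{Regret}(M_\theta,\mathfrak A,K)]\ge\frac{(d-1)H^{3/2}\sqrt K}{480\sqrt2}$, where the expectation is over the randomness of $M_\theta$ and $\mathfrak A$.
   Context: Episodic setting: $K$ episodes, each of horizon $H$ starting at state $x_1$; in step $h$ the agent picks $a_h$, gets reward $r(s_h,a_h)$, and $s_{h+1}$ is drawn from the step-$h$ transition. An algorithm chooses (possibly randomly, based on past episodes) a policy $\pi^k$ for episode $k$; $V_1^\pi(x_1)=\mathbb E[\sum_{h=1}^Hr(s_h,a_h)\mid s_1=x_1]$, $V_1^*(x_1)=\max_\pi V_1^\pi(x_1)$, and $\mathrm{Regret}(M_\theta,\mathfrak A,K)=\sum_{k=1}^K(V_1^*(x_1)-V_1^{\pi^k}(x_1))$. Family $M_\theta$: states $x_1,\dots,x_{H+2}$, with $x_{H+1},x_{H+2}$ absorbing; actions $\mathcal A=\{-1,1\}^{d-1}$; reward $r(x_i,a)=1$ if $i=H+2$ and $0$ otherwise. Let $\delta=1/H$, $\Delta=1/(4\sqrt{2HK})$, $\bar\Delta=\frac1{d-1}\log\frac{(1-\delta)(\delta+(d-1)\Delta)}{\delta(1-\delta-(d-1)\Delta)}$, $\alpha=\sqrt{\bar\Delta/(1+(d-1)\bar\Delta)}$, $\beta=\sqrt{1/(1+(d-1)\bar\Delta)}$.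 Features $\varphi(x_h,a,x_{H+2})=(0,0)\in\mathbb R^{d}$ and $\varphi(x_h,a,x_{h+1})=(-\alpha a,\beta\log(H-1))\in\mathbb R^{d-1}\times\mathbb R$ for $h\in[H]$. $\theta=\{\theta_h\}_{h=1}^H$ with $\theta_h\in\{-\bar\Delta,\bar\Delta\}^{d-1}$, and the step-$h$ transition core is $\bar\theta_h=(\theta_h/\alpha,1/\beta)$; transitions from $x_h$ are MNL over $\{x_{h+1},x_{H+2}\}$: $p(x_j\mid x_h,a)=\exp(\varphi(x_h,a,x_j)^\top\bar\theta_h)/\sum_{j'\in\{h+1,H+2\}}\exp(\varphi(x_h,a,x_{j'})^\top\bar\theta_h)$, so $p(x_{H+2}\mid x_h,a)=1/(1+(H-1)e^{-a^\top\theta_h})$. $L_\theta=\max_h\|\bar\theta_h\|_2$ and $L_\varphi=\max\|\varphi(x_i,a,x_j)\|_2$. *)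

(* Defs.v *)
From HB Require Import structures.
From mathcomp Require Import all_boot all_order all_algebra.
From mathcomp Require Import all_classical all_reals all_analysis.
Set Implicit Arguments. Unset Strict Implicit. Unset Printing Implicit Defensive.
Import Order.TTheory GRing.Theory Num.Theory.
Local Open Scope ring_scope.

Section Episodic.
Variables (R : realType) (S A : finType) (H : nat).

Definition policy := {ffun 'I_H -> {ffun S -> A}}.
(* state trajectory s_1, ..., s_{H+1} (0-based indices 0..H) *)
Definition traj := {ffun 'I_H.+1 -> S}.

Definition cur (h : 'I_H) : 'I_H.+1 := widen_ord (leqnSn H) h.
Definition nxt (h : 'I_H) : 'I_H.+1 := lift ord0 h.

Variables (P : 'I_H -> S -> A -> S -> R) (r : S -> A -> R) (x1 : S).

Definition traj_prob (pi : policy) (tau : traj) : R :=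
  (tau ord0 == x1)%:R *
  \prod_(h < H) P h (tau (cur h)) (pi h (tau (cur h))) (tau (nxt h)).

Definition traj_reward (pi : policy) (tau : traj) : R :=
  \sum_(h < H) r (tau (cur h)) (pi h (tau (cur h))).

Definition value (pi : policy) : R :=
  \sum_(tau : traj) traj_prob pi tau * traj_reward pi tau.

Definition opt_value : R := \big[Num.max/0]_(pi : policy) value pi.

(* A (randomized) algorithm: given the history of past episodes
   (the policies it played and the observed trajectories), a probability
   distribution over the policy to play in the next episode. *)
Definition algorithm := seq (policy * traj) -> policy -> R.

Definition valid_alg (alg : algorithm) : Prop :=
  forall hist, (forall pi, 0 <= alg hist pi) /\ \sum_(pi : policy) alg hist pi = 1.

Definition hist_prob (K : nat) (alg : algorithm) (hs : K.-tuple (policy * traj)) : R :=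
  \prod_(k < K) (alg (take k hs) (tnth hs k).1 * traj_prob (tnth hs k).1 (tnth hs k).2).

Definition regret (K : nat) (hs : K.-tuple (policy * traj)) : R :=
  \sum_(k < K) (opt_value - value (tnth hs k).1).

Definition expected_regret (K : nat) (alg : algorithm) : R :=
  \sum_(hs : K.-tuple (policy * traj)) hist_prob alg hs * regret hs.

End Episodic.

Section HardFamily.
Variables (R : realType) (d H K : nat).

(* state i : 'I_(H+2) stands for x_{i+1}; so ord0 = x_1, ord_max = x_{H+2} *)
Definition St := 'I_(H.+2).
(* action a in {-1,1}^{d-1}; coordinate c is sgn (a c) *)
Definition Act := {ffun 'I_(d.-1) -> bool}.
Definition sgn (b : bool) : R := if b then 1 else -1.

Definition x1 : St := ord0.

Definition delta : R := (H%:R)^-1.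
Definition Delta : R := (4 * Num.sqrt (2 * H%:R * K%:R))^-1.
Definition Deltabar : R :=
  ((d.-1)%:R)^-1 *
  ln (((1 - delta) * (delta + (d.-1)%:R * Delta)) /
      (delta * (1 - delta - (d.-1)%:R * Delta))).
Definition alpha : R := Num.sqrt (Deltabar / (1 + (d.-1)%:R * Deltabar)).
Definition beta : R := Num.sqrt ((1 + (d.-1)%:R * Deltabar)^-1).

(* vectors of R^d = R^{d-1} x R: coordinates 'I_(d-1).+1, the last one is ord_max *)
Definition vec := 'I_(d.-1).+1 -> R.
Definition dotv (u v : vec) : R := \sum_(c < (d.-1).+1) u c * v c.
Definition norm2 (u : vec) : R := Num.sqrt (\sum_(c < (d.-1).+1) u c ^+ 2).

(* phi(x_h, a, x_{h+1}) = (-alpha a, beta log(H-1)) for h in [H];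
   phi(x_h, a, x_{H+2}) = 0; all other (unused) triples are 0 as well *)
Definition feature (i : St) (a : Act) (j : St) : vec := fun c =>
  if (i < H)%N && (nat_of_ord j == i.+1)%N then
    (if unlift ord_max c is Some c' then - alpha * sgn (a c')
     else beta * ln (H%:R - 1))
  else 0.

Definition param := 'I_H -> 'I_(d.-1) -> R.
Definition core (theta : param) (h : 'I_H) : vec := fun c =>
  if unlift ord_max c is Some c' then theta h c' / alpha else beta^-1.

(* step-h transition: from x_i (i in [H]) MNL over {x_{i+1}, x_{H+2}};
   x_{H+1}, x_{H+2} absorbing *)
Definition trans (theta : param) (h : 'I_H) (i : St) (a : Act) (j : St) : R :=
  if (i < H)%N then
    (if (nat_of_ord j == i.+1)%N || (j == ord_max) then
       expR (dotv (feature i a j) (core theta h)) /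
       (expR (dotv (feature i a (inord i.+1)) (core theta h)) +
        expR (dotv (feature i a ord_max) (core theta h)))
     else 0)
  else (j == i)%:R.

Definition reward (i : St) (a : Act) : R := (i == ord_max)%:R.

Definition Ltheta (theta : param) : R :=
  \big[Num.max/0]_(h < H) norm2 (core theta h).
Definition Lphi : R :=
  \big[Num.max/0]_(t : St * Act * St) norm2 (feature t.1.1 t.1.2 t.2).

End HardFamily.

(* Main.v *)
(** The step-h jump probability is [jump x], where x is the inner product of
    action and parameter. The value of a policy is H minus the expected number
    of steps before the jump ([surv]), so every wrong sign of the action taken
    at step h costs a factor of order (H - h) Delta. Flipping one sign of the
    parameter changes the jump probabilities of a single step, by O(Delta), so
    the Hellinger affinity of the laws of one episode is 1 - O(1/K) whatever the
    policy; affinities multiply along episodes even for adaptive algorithms, so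
    the laws of the full history keep a constant overlap and each sign is wrong
    a constant fraction of the time, on average over all sign vectors. *)
Require Import Defs.
From HB Require Import structures.
From mathcomp Require Import all_boot all_order all_algebra.
From mathcomp Require Import all_classical all_reals all_analysis.
From mathcomp Require Import ring lra.
Import Order.TTheory GRing.Theory Num.Theory.
Local Open Scope ring_scope.

Set Implicit Arguments.
Unset Strict Implicit.
Unset Printing Implicit Defensive.

(** * Path sums of inhomogeneous Markov chains *)

Section Paths.
Variables (R : realType) (S : finType).

Definition scons n (s : S) (tau : {ffun 'I_n.+1 -> S}) : {ffun 'I_n.+2 -> S} :=
  [ffun i => if unlift ord0 i is Some j then tau j else s].

Lemma scons0 n s (tau : {ffun 'I_n.+1 -> S}) : scons s tau ord0 = s.
Proof. by rewrite ffunE unlift_none. Qed.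

Lemma sconsS n s (tau : {ffun 'I_n.+1 -> S}) i : scons s tau (lift ord0 i) = tau i.
Proof. by rewrite ffunE liftK. Qed.

Lemma sum_scons n (F : {ffun 'I_n.+2 -> S} -> R) :
  \sum_tau F tau = \sum_s \sum_tau F (scons s tau).
Proof.
rewrite pair_big /=.
rewrite (reindex (fun x : S * {ffun 'I_n.+1 -> S} => scons x.1 x.2)) //=.
exists (fun tau => (tau ord0, [ffun i => tau (lift ord0 i)])).
- move=> [s tau] _ /=; rewrite scons0; congr pair.
  by apply/ffunP => i; rewrite ffunE sconsS.
- move=> tau _ /=; apply/ffunP => i; rewrite ffunE.
  by case: unliftP => [j ->|->]; rewrite ?ffunE.
Qed.

(** [Q] need not be stochastic: with square roots of products of two transition probabilities as
    entries, the sums of these weights are Hellinger affinities. *)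
Definition path_weight n (Q : 'I_n -> S -> S -> R) (s : S) (tau : {ffun 'I_n.+1 -> S}) : R :=
  (tau ord0 == s)%:R * \prod_(h < n) Q h (tau (cur h)) (tau (nxt h)).

Definition family_tail (T : Type) n (Q : 'I_n.+1 -> T) : 'I_n -> T :=
  fun h => Q (lift ord0 h).

(** Only [s' = tau ord0] contributes on the right; it is kept as a sum so that the summation over
    [tau] can be exchanged with it. *)
Lemma path_weight_scons n (Q : 'I_n.+1 -> S -> S -> R) s s0 tau :
  path_weight Q s (scons s0 tau) =
  (s0 == s)%:R * \sum_s' Q ord0 s s' * path_weight (family_tail Q) s' tau.
Proof.
unfold path_weight; rewrite scons0 big_ord_recl.
have [->|] := eqVneq s0 s; last by rewrite !mul0r.
rewrite !mul1r (bigD1 (tau ord0)) //= [X in _ = _ + X]big1 ?addr0; last first.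
  by move=> s' ns; rewrite eq_sym (negbTE ns) mul0r mulr0.
rewrite eqxx mul1r.
have -> : cur (ord0 : 'I_n.+1) = ord0 by apply/val_inj.
rewrite scons0 /nxt sconsS; congr (_ * _).
apply: eq_bigr => h _.
have -> : cur (lift ord0 h) = lift ord0 (cur h) by apply/val_inj.
by rewrite !sconsS.
Qed.

(** First-step decomposition. Head and tail are separate arguments of [F], so that the mass and the
    accumulated reward are both instances. *)
Lemma sum_path_weightS n (Q : 'I_n.+1 -> S -> S -> R) s
    (F : S -> {ffun 'I_n.+1 -> S} -> R) :
  \sum_s0 \sum_tau path_weight Q s (scons s0 tau) * F s0 tau =
  \sum_s' Q ord0 s s' * \sum_tau path_weight (family_tail Q) s' tau * F s tau.
Proof.
rewrite (bigD1 s) //= [X in _ + X]big1 ?addr0; last first.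
  move=> s0 ns; rewrite big1 // => tau _.
  by rewrite path_weight_scons (negbTE ns) !mul0r.
under eq_bigr => tau _ do rewrite path_weight_scons eqxx mul1r mulr_suml.
rewrite exchange_big; apply: eq_bigr => s' _.
by rewrite mulr_sumr; apply: eq_bigr => tau _; rewrite mulrA.
Qed.

Lemma mass_path_weightS n (Q : 'I_n.+1 -> S -> S -> R) s :
  \sum_tau path_weight Q s tau =
  \sum_s' Q ord0 s s' * \sum_tau path_weight (family_tail Q) s' tau.
Proof.
rewrite sum_scons.
have := sum_path_weightS Q s (fun _ _ => 1).
under eq_bigr do under eq_bigr do rewrite mulr1.
move=> ->; apply: eq_bigr => s' _; congr (_ * _).
by apply: eq_bigr => tau _; rewrite mulr1.
Qed.

Lemma mass_path_weight0 (Q : 'I_0 -> S -> S -> R) s :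
  \sum_tau path_weight Q s tau = 1.
Proof.
rewrite (bigD1 [ffun => s]) //= big1 ?addr0 => [|tau nt].
  by rewrite /path_weight big_ord0 mulr1 ffunE eqxx.
rewrite /path_weight; case: eqP => [ts|]; last by rewrite mul0r.
case/eqP: nt; apply/ffunP => i; rewrite ffunE -ts; congr (tau _).
by apply/val_inj; case: i => [[|]].
Qed.

Lemma mass_path_weight n (Q : 'I_n -> S -> S -> R) s :
  (forall h x, \sum_y Q h x y = 1) -> \sum_tau path_weight Q s tau = 1.
Proof.
elim: n Q s => [|n IH] Q s HQ; first exact: mass_path_weight0.
rewrite mass_path_weightS -[RHS](HQ ord0 s); apply: eq_bigr => s' _.
by rewrite IH ?mulr1 // => h x; apply: HQ.
Qed.

(** Tensorization of the affinity along the steps: the bounds [c h] hold from every state, so they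
    come out of the nested sums one by one. *)
Lemma mass_path_weight_ge n (Q : 'I_n -> S -> S -> R) (c : 'I_n -> R) s :
  (forall h x y, 0 <= Q h x y) -> (forall h, 0 <= c h) ->
  (forall h x, c h <= \sum_y Q h x y) ->
  \prod_h c h <= \sum_tau path_weight Q s tau.
Proof.
elim: n Q c s => [|n IH] Q c s Q0 c0 HQ; first by rewrite mass_path_weight0 big_ord0.
rewrite mass_path_weightS big_ord_recl.
apply: le_trans (_ : \sum_s' Q ord0 s s' * \prod_(h < n) family_tail c h <= _).
  by rewrite -mulr_suml ler_wpM2r // prodr_ge0 // => h _; apply: c0.
apply: ler_sum => s' _; apply: ler_wpM2l => //.
by apply: IH => *; [apply: Q0 | apply: c0 | apply: HQ].
Qed.

Definition path_reward n (Q : 'I_n -> S -> S -> R) (r : S -> R) (s : S) : R :=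
  \sum_tau path_weight Q s tau * \sum_(h < n) r (tau (cur h)).

(** The Bellman equation of a fixed policy. *)
Lemma path_rewardS n (Q : 'I_n.+1 -> S -> S -> R) (r : S -> R) s :
  (forall h x, \sum_y Q h x y = 1) ->
  path_reward Q r s = r s + \sum_s' Q ord0 s s' * path_reward (family_tail Q) r s'.
Proof.
move=> HQ; rewrite /path_reward sum_scons.
pose F (s0 : S) (tau : {ffun 'I_n.+1 -> S}) := r s0 + \sum_(h < n) r (tau (cur h)).
have E s0 tau : \sum_(h < n.+1) r (scons s0 tau (cur h)) = F s0 tau.
  rewrite big_ord_recl.
  have -> : cur (ord0 : 'I_n.+1) = ord0 by apply/val_inj.
  rewrite scons0; congr (_ + _); apply: eq_bigr => h _.
  have -> : cur (lift ord0 h) = lift ord0 (cur h) by apply/val_inj.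
  by rewrite sconsS.
under eq_bigr do under eq_bigr do rewrite E.
rewrite sum_path_weightS.
(* The unit row sum spreads [r s] over the successor states. *)
rewrite -[X in X + _]mulr1 -(HQ ord0 s) mulr_sumr -big_split /=.
apply: eq_bigr => s' _; rewrite (mulrC (r s)) -mulrDr; congr (_ * _).
under eq_bigr do rewrite mulrDr.
rewrite big_split /= -mulr_suml mass_path_weight ?mul1r // => h x; exact: HQ.
Qed.

End Paths.

(** * Laws of histories under an adaptive algorithm *)

Section Histories.
Variables (R : realType) (S A : finType) (H : nat).
Local Notation pol := (policy S A H).
Local Notation trj := (traj S H).
Variable alg : algorithm R S A H.

(** For [g] a trajectory law this is [hist_prob]; a general [g] also covers the geometric mean of
    two laws. *)
Definition hist_weight (g : pol -> trj -> R) K (hs : K.-tuple (pol * trj)) : R :=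
  \prod_(k < K) (alg (take k hs) (tnth hs k).1 * g (tnth hs k).1 (tnth hs k).2).

(** The last episode is split off, not the first, because the algorithm consults the prefix before
    it. *)
Lemma sum_rcons_tuple (T : finType) K (F : K.+1.-tuple T -> R) :
  \sum_hs F hs = \sum_(hs : K.-tuple T) \sum_x F [tuple of rcons hs x].
Proof.
rewrite pair_big /=.
rewrite (reindex (fun p : K.-tuple T * T => [tuple of rcons p.1 p.2])) //=.
exists (fun hs : K.+1.-tuple T =>
  ([tuple of belast (thead hs) (behead hs)], last (thead hs) (behead hs))).
- move=> [[[|y s] Hs] x] _ /=; congr pair; rewrite ?last_rcons //; apply: val_inj => //=.
  by rewrite /thead (tnth_nth x) /= belast_rcons.
- move=> hs _ /=; apply: val_inj => /=; rewrite -lastI.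
  by case/tupleP: hs => y hs; rewrite /= theadE.
Qed.

Lemma hist_weight_rcons g K (hs : K.-tuple (pol * trj)) x :
  hist_weight g [tuple of rcons hs x] = hist_weight g hs * (alg hs x.1 * g x.1 x.2).
Proof.
rewrite /hist_weight big_ord_recr /=; congr (_ * _).
  apply: eq_bigr => k _ /=.
  have -> : tnth [tuple of rcons hs x] (widen_ord (leqnSn K) k) = tnth hs k.
    by rewrite !(tnth_nth x) /= nth_rcons size_tuple ltn_ord.
  by rewrite -cats1 takel_cat // size_tuple ltnW.
have -> : tnth [tuple of rcons hs x] ord_max = x.
  by rewrite (tnth_nth x) /= nth_rcons size_tuple ltnn eqxx.
by rewrite -cats1 take_size_cat // size_tuple.
Qed.

Lemma sum_hist_weightS g K :
  \sum_(hs : K.+1.-tuple (pol * trj)) hist_weight g hs =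
  \sum_(hs : K.-tuple (pol * trj)) hist_weight g hs * \sum_p alg hs p * \sum_t g p t.
Proof.
rewrite sum_rcons_tuple; apply: eq_bigr => hs _.
under eq_bigr do rewrite hist_weight_rcons.
rewrite -mulr_sumr; congr (_ * _).
under [RHS]eq_bigr do rewrite mulr_sumr.
by rewrite pair_big.
Qed.

Lemma sum_hist_weight0 g : \sum_(hs : 0.-tuple (pol * trj)) hist_weight g hs = 1.
Proof.
rewrite (bigD1 [tuple]) //= big1 ?addr0 => [|t]; last by case/eqP; exact: tuple0.
by rewrite /hist_weight big_ord0.
Qed.

Hypothesis alg_valid : valid_alg alg.

Lemma sum_hist_weight g K : (forall p, \sum_t g p t = 1) ->
  \sum_(hs : K.-tuple (pol * trj)) hist_weight g hs = 1.
Proof.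
move=> g1; elim: K => [|K IH]; first exact: sum_hist_weight0.
rewrite sum_hist_weightS -[RHS]IH; apply: eq_bigr => hs _.
under eq_bigr do rewrite g1 mulr1.
by rewrite (proj2 (alg_valid hs)) mulr1.
Qed.

Lemma hist_weight_ge0 g K (hs : K.-tuple (pol * trj)) :
  (forall p t, 0 <= g p t) -> 0 <= hist_weight g hs.
Proof.
move=> g0; apply: prodr_ge0 => k _; apply: mulr_ge0 => //.
by case: (alg_valid (take k hs)).
Qed.

(** Adaptivity does no harm: [c] bounds one episode uniformly in the policy, so averaging over the
    algorithm's choice keeps the factor [c]. *)
Lemma sum_hist_weight_ge g (c : R) K : 0 <= c -> (forall p t, 0 <= g p t) ->
  (forall p, c <= \sum_t g p t) ->
  c ^+ K <= \sum_(hs : K.-tuple (pol * trj)) hist_weight g hs.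
Proof.
move=> c0 g0 gc; elim: K => [|K IH]; first by rewrite sum_hist_weight0 expr0.
rewrite sum_hist_weightS exprSr.
apply: le_trans (_ : (\sum_(hs : K.-tuple (pol * trj)) hist_weight g hs) * c <= _).
  exact: ler_wpM2r.
rewrite mulr_suml; apply: ler_sum => hs _; apply: ler_wpM2l.
  exact: hist_weight_ge0.
case: (alg_valid hs) => a0 a1.
rewrite -[c]mul1r -a1 mulr_suml; apply: ler_sum => p _; exact: ler_wpM2l.
Qed.

(** The algorithm's factors are the same under both laws, so only the trajectory factors need a
    square root. *)
Lemma hist_weight_sqrt (g1 g2 : pol -> trj -> R) K (hs : K.-tuple (pol * trj)) :
  (forall p t, 0 <= g1 p t) -> (forall p t, 0 <= g2 p t) ->
  hist_weight (fun p t => Num.sqrt (g1 p t * g2 p t)) hs ^+ 2 =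
  hist_weight g1 hs * hist_weight g2 hs.
Proof.
move=> g10 g20; rewrite /hist_weight -prodrXl -big_split; apply: eq_bigr => k _ /=.
rewrite exprMn sqr_sqrtr ?mulr_ge0 //; ring.
Qed.

(** The affinity of the two history laws is at least [c ^+ K]; passing to the minimum costs a
    quarter of the total mass of each law, hence 1/2. *)
Lemma sum_min_hist_weight (g1 g2 : pol -> trj -> R) (c : R) K :
  (forall p t, 0 <= g1 p t) -> (forall p t, 0 <= g2 p t) ->
  (forall p, \sum_t g1 p t = 1) -> (forall p, \sum_t g2 p t = 1) ->
  0 <= c -> (forall p, c <= \sum_t Num.sqrt (g1 p t * g2 p t)) ->
  c ^+ K - 2^-1 <= \sum_(hs : K.-tuple (pol * trj))
    Num.min (hist_weight g1 hs) (hist_weight g2 hs).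
Proof.
move=> g10 g20 m1 m2 c0 gc.
pose g p t := Num.sqrt (g1 p t * g2 p t).
have := @sum_hist_weight_ge g c K c0 (fun _ _ => sqrtr_ge0 _) gc.
have E1 := sum_hist_weight K m1; have E2 := sum_hist_weight K m2.
suff : \sum_(hs : K.-tuple (pol * trj))
    (hist_weight g hs - 4^-1 * (hist_weight g1 hs + hist_weight g2 hs))
   <= \sum_(hs : K.-tuple (pol * trj)) Num.min (hist_weight g1 hs) (hist_weight g2 hs).
  by rewrite big_split /= sumrN -mulr_sumr big_split /= E1 E2; lra.
apply: ler_sum => hs _.
have := hist_weight_sqrt hs g10 g20; rewrite -/g.
have := hist_weight_ge0 hs g10; have := hist_weight_ge0 hs g20.
have := @hist_weight_ge0 g _ hs (fun _ _ => sqrtr_ge0 _).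
move: (hist_weight g hs) (hist_weight g1 hs) (hist_weight g2 hs) => u a b u0 b0 a0 uab.
(* The overlap bound is [min a b >= sqrt (a * b) - max a b / 4]. *)
have amgm (x y : R) : 0 <= x -> 0 <= y -> u ^+ 2 = x * y -> u <= x + 4^-1 * y.
  move=> x0 y0 E; rewrite -(@ler_pXn2r _ 2) ?nnegrE ?addr_ge0 ?mulr_ge0 // E.
  have := sqr_ge0 (x - 4^-1 * y); nra.
have [_|_] := leP a b.
  have := amgm a b a0 b0 uab; lra.
have := amgm b a b0 a0; rewrite mulrC => /(_ uab); lra.
Qed.

End Histories.

(** * Estimates for the jump probabilities *)

Lemma bernoulli_ineq (R : realType) (x : R) m : -1 <= x -> 1 + m%:R * x <= (1 + x) ^+ m.
Proof.
move=> x1; elim: m => [|m IH]; first by rewrite mul0r addr0 expr0.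
rewrite exprS; apply: le_trans (_ : (1 + x) * (1 + m%:R * x) <= _); last first.
  by apply: ler_wpM2l => //; lra.
rewrite -natr1; have := ler0n R m; have := sqr_ge0 x; nra.
Qed.

(** Trading the geometric for the harmonic mean turns affinities into rational functions. *)
Lemma sqrt_mul_ge_harmonic (R : realType) (a b : R) : 0 < a -> 0 < b ->
  2 * a * b / (a + b) <= Num.sqrt (a * b).
Proof.
move=> a0 b0; rewrite ler_pdivrMr ?addr_gt0 //.
have ab0 : 0 <= a * b by rewrite mulr_ge0 // ltW.
rewrite -mulrA -{1}(sqr_sqrtr ab0).
have E : Num.sqrt a ^+ 2 = a by rewrite sqr_sqrtr // ltW.
have F : Num.sqrt b ^+ 2 = b by rewrite sqr_sqrtr // ltW.
rewrite sqrtrM ?(ltW a0) // -{3}E -{3}F.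
have := sqrtr_ge0 a; have := sqrtr_ge0 b.
move: (Num.sqrt a) (Num.sqrt b) => u v v0 u0.
have := mulr_ge0 u0 v0; have := sqr_ge0 (u - v); nra.
Qed.

(** The harmonic means add up to exactly 1 - (p - q)^2 / ((p + q)(2 - p - q)). The coarser
    denominator is the one that cancels against the factorization [jump_sub]. *)
Lemma bernoulli_affinity (R : realType) (p q : R) : 0 < q -> q <= p -> p < 1 ->
  1 - (p - q) ^+ 2 / (4 * (q * (1 - p))) <=
  Num.sqrt (p * q) + Num.sqrt ((1 - p) * (1 - q)).
Proof.
move=> q0 qp p1.
have p0 : 0 < p by lra.
have := sqrt_mul_ge_harmonic p0 q0.
have p1' : 0 < 1 - p by lra.
have q1' : 0 < 1 - q by lra.
have := sqrt_mul_ge_harmonic p1' q1'.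
suff : 1 - (p - q) ^+ 2 / (4 * (q * (1 - p))) <=
  2 * p * q / (p + q) + 2 * (1 - p) * (1 - q) / (1 - p + (1 - q)) by lra.
have -> : 2 * p * q / (p + q) + 2 * (1 - p) * (1 - q) / (1 - p + (1 - q)) =
   1 - (p - q) ^+ 2 / ((p + q) * (1 - p + (1 - q))).
  field; apply/andP; split; apply: lt0r_neq0; lra.
rewrite lerD2l lerN2; apply: ler_wpM2l; first exact: sqr_ge0.
have A : 0 < q * (1 - p) by exact: mulr_gt0.
have B : 4 * (q * (1 - p)) <= (p + q) * (1 - p + (1 - q)).
  have C : 0 <= p - q by lra.
  have := mulr_ge0 C (ltW q0); have := mulr_ge0 C (ltW p1'); have := sqr_ge0 (p - q); lra.
rewrite lef_pV2 ?posrE //; lra.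
Qed.

(** * The jump probability as a function of the score *)

Section Jump.
Variables (R : realType) (H : nat).
Hypothesis H3 : (3 <= H)%N.

Let h3 : 3 <= H%:R :> R. Proof. by rewrite (ler_nat R 3 H). Qed.

Definition jump (x : R) : R := (1 + (H%:R - 1) * expR (- x))^-1.

Lemma jump_den (x : R) : 0 < 1 + (H%:R - 1) * expR (- x).
Proof. by have ? := h3; rewrite addr_gt0 ?mulr_gt0 ?expR_gt0 //; lra. Qed.

Lemma jump_gt0 (x : R) : 0 < jump x. Proof. by rewrite invr_gt0 jump_den. Qed.

Lemma jump_lt1 (x : R) : jump x < 1.
Proof.
by have ? := h3; rewrite invf_lt1 ?jump_den // ltrDl mulr_gt0 ?expR_gt0 //; lra.
Qed.

(** An exact factorization, behind monotonicity, the lower bound on the loss and the upper bound on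
    the information alike. *)
Lemma jump_sub (x y : R) :
  jump y - jump x = jump x * (1 - jump y) * (expR (y - x) - 1).
Proof.
have := jump_den x; have := jump_den y; rewrite /jump.
have -> : expR (- x) = expR (- y) * expR (y - x) by rewrite -expRD; congr expR; lra.
move=> a b; field; apply/andP; split; exact: lt0r_neq0.
Qed.

Lemma jump_le (x y : R) : x <= y -> jump x <= jump y.
Proof.
move=> xy; rewrite -subr_ge0 jump_sub.
have E : 1 <= expR (y - x) by rewrite -expR0 ler_expR; lra.
by have ? := jump_gt0 x; have ? := jump_lt1 y; rewrite !mulr_ge0 //; lra.
Qed.

(** The denominator in [bernoulli_affinity] cancels one copy of [jump x * (1 - jump y)]. The
    surviving factor [jump x], of order 1/H, is what brings the loss for a sign flip down to order
    1/K. *)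
Lemma jump_affinity (x y : R) : x <= y ->
  1 - jump x * (expR (y - x) - 1) ^+ 2 / 4 <=
  Num.sqrt (jump y * jump x) + Num.sqrt ((1 - jump y) * (1 - jump x)).
Proof.
move=> xy; apply: le_trans (bernoulli_affinity (jump_gt0 x) (jump_le xy) (jump_lt1 y)).
have x0 := jump_gt0 x; have y1 := jump_lt1 y; have y0 := jump_gt0 y.
rewrite jump_sub; set E := expR _ - 1.
have -> : (jump x * (1 - jump y) * E) ^+ 2 / (4 * (jump x * (1 - jump y))) =
    jump x * (1 - jump y) * E ^+ 2 / 4.
  by field; apply/andP; split; apply: lt0r_neq0; lra.
have := mulr_ge0 (mulr_ge0 (ltW x0) (ltW y0)) (sqr_ge0 E); lra.
Qed.

End Jump.

(** * Numerical bounds on Delta, Deltabar and the extreme jump probabilities *)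

Section Scalars.
Variables (R : realType) (d H K : nat).
Hypotheses (d2 : (2 <= d)%N) (H3 : (3 <= H)%N).
Hypothesis HK : Num.max ((d.-1)%:R ^+ 2 * H%:R / 2)
  (H%:R ^+ 3 * (d.-1)%:R ^+ 2 / 32) <= K%:R :> R.

Local Notation n := ((d.-1)%:R : R).
Local Notation h := (H%:R : R).
Local Notation k := (K%:R : R).
Local Notation D := (Delta R H K).
Local Notation Db := (Deltabar R d H K).
(** The largest increase of the jump probability, relative to its value 1/H at score 0; see
    [jump_max]. *)
Let t : R := n * h * D.

Let h3 : 3 <= h. Proof. by rewrite (ler_nat R 3 H). Qed.
Let n1 : 1 <= n. Proof. by rewrite (ler_nat R 1); case: d d2 => [|[]]. Qed.

Lemma horizon_episodes_gt0 : 0 < h * k.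
Proof.
have ? := h3; have ? := n1.
move: HK; rewrite ge_max => /andP[K1 _].
rewrite mulr_gt0 //; first by lra.
by apply: lt_le_trans K1; rewrite !mulr_gt0 ?exprn_gt0 ?invr_gt0 //; lra.
Qed.

Let s := Num.sqrt (2 * h * k).
Let s2 : s ^+ 2 = 2 * h * k.
Proof. by rewrite sqr_sqrtr //; have := horizon_episodes_gt0; lra. Qed.
Let s0 : 0 < s. Proof. by rewrite sqrtr_gt0; have := horizon_episodes_gt0; lra. Qed.

Lemma Delta_gt0 : 0 < D.
Proof. by rewrite /Delta invr_gt0 mulr_gt0. Qed.

Lemma Delta_sqr : 32 * (h * k) * D ^+ 2 = 1.
Proof.
have ? := h3.
rewrite /Delta -/s exprVn exprMn s2.
have h0 : 0 < h by lra.
have k0 : 0 < k by rewrite -(pmulr_rgt0 _ h0) horizon_episodes_gt0.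
by field; rewrite !lt0r_neq0.
Qed.

Let t0 : 0 < t.
Proof.
have ? := h3; have ? := n1.
rewrite /t !mulr_gt0 ?Delta_gt0 //; lra. Qed.

(** The first lower bound on K squares to [n * h <= s], and t = nh / (4s). *)
Let t4 : t <= 4^-1.
Proof.
have ? := h3; have ? := n1; have ? := s0.
rewrite /t /Delta -/s ler_pdivrMr ?mulr_gt0 //.
suff : n * h <= s by lra.
rewrite -(@ler_pXn2r _ 2) ?nnegrE ?(ltW s0) ?mulr_ge0 //; try lra.
move: HK; rewrite s2 ge_max => /andP[K1 _].
have := ler_wpM2l (ler0n R H) K1; lra.
Qed.

(** The second lower bound on K, used for [Deltabar_ge]. *)
Let th : t * h <= 1.
Proof.
have ? := h3; have ? := n1; have ? := s0.
rewrite /t /Delta -/s mulrAC ler_pdivrMr ?mulr_gt0 // mul1r.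
suff : n * h ^+ 2 / 4 <= s by lra.
rewrite -(@ler_pXn2r _ 2) ?nnegrE ?(ltW s0) ?divr_ge0 ?mulr_ge0 ?sqr_ge0 //; try lra.
move: HK; rewrite s2 ge_max => /andP[_ K1].
have := ler_wpM2l (ler0n R H) K1; lra.
Qed.

(** The ratio of the odds of the probabilities (1 + t)/H and 1/H; Deltabar is chosen so that its
    logarithm is [n * Db]. *)
Let Y := (h - 1) * (1 + t) / (h - 1 - t).

Let YE : expR (n * Db) = Y.
Proof.
have ? := h3; have ? := n1; have ? := t0; have ? := t4.
rewrite /Deltabar mulrA divff ?mul1r; last by apply: lt0r_neq0; lra.
have -> : ((1 - delta R H) * (delta R H + n * D)) / (delta R H * (1 - delta R H - n * D)) = Y.
  rewrite /Y /delta.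
  have -> : D = t / (n * h) by rewrite /t; field; apply/andP; split; apply: lt0r_neq0; lra.
  field; rewrite !lt0r_neq0 //=; lra.
rewrite lnK // posrE /Y divr_gt0 ?mulr_gt0 //; lra.
Qed.

(** The quotient h / (h - 1 - t) is largest at h = 3, t = 1/4, where it is 12/7. *)
Let Y1 : Y - 1 <= 12 / 7 * t.
Proof.
have ? := h3; have ? := n1; have ? := t0; have ? := t4.
have -> : Y - 1 = h * t / (h - 1 - t) by rewrite /Y; field; apply: lt0r_neq0; lra.
rewrite ler_pdivrMr; [nra|lra].
Qed.

(* [lra] ignores section definitions, hence the copies. *)
Ltac bounds :=
  have ? := h3; have ? := n1; have ? := t0; have ? := t4; have ? := th; have ? := Y1.

Lemma expR_nDeltabar_le : expR (n * Db) <= 10 / 7.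
Proof.
bounds.
by rewrite YE; lra. Qed.

Lemma nDeltabar_le : n * Db <= 3 / 7.
Proof.
bounds.
by have := expR_ge1Dx (n * Db); rewrite YE; lra. Qed.

(** From ln Y >= 1 - 1/Y; the remaining inequality (h - 1)(1 + t) <= h follows from [th]. *)
Lemma Deltabar_ge : h * D <= Db.
Proof.
bounds.
rewrite -(@ler_pM2l _ n); last by lra.
have := expR_ge1Dx (- (n * Db)); rewrite expRN YE => E.
suff : t <= 1 - Y^-1 by rewrite /t; lra.
have -> : 1 - Y^-1 = h * t / ((h - 1) * (1 + t)).
  by rewrite /Y; field; rewrite !lt0r_neq0 //=; lra.
rewrite ler_pdivlMr; last by nra.
suff : (h - 1) * (1 + t) <= h by nra.
nra.
Qed.

Lemma Deltabar_gt0 : 0 < Db.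
Proof.
bounds.
by apply: lt_le_trans Deltabar_ge; rewrite mulr_gt0 ?Delta_gt0 //; lra. Qed.

(** With E = exp Deltabar, Bernoulli's inequality applied to E^n = Y gives E - 1 <= 12/7 h Delta,
    free of n. Then E^2 - 1 = (E - 1)(E + 1) with E + 1 <= 17/7. *)
Lemma expR_2Deltabar_le : expR (2 * Db) - 1 <= 204 / 49 * (h * D).
Proof.
bounds.
have Db0 := Deltabar_gt0; set E := expR Db.
have E1 : 1 + Db <= E := expR_ge1Dx Db.
have EY : E <= 10 / 7.
  apply: le_trans expR_nDeltabar_le; rewrite ler_expR; nra.
have := @bernoulli_ineq R (E - 1) d.-1; rewrite (addrC 1 (E - 1)) subrK -expRM_natl YE.
move=> /(_ ltac:(lra)) B.
have {}B : E - 1 <= 12 / 7 * (h * D).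
  rewrite -(@ler_pM2l _ n); last by lra.
  move: Y1; rewrite /t; lra.
by rewrite expRM_natl -/E; nra.
Qed.

Lemma jump_max : jump H (n * Db) = (1 + t) / h.
Proof.
bounds.
rewrite /jump expRN YE /Y; field; rewrite !lt0r_neq0 //=; nra.
Qed.

Lemma jump_max_le : jump H (n * Db) <= 5 / 4 / h.
Proof.
bounds.
by rewrite jump_max ler_pM2r ?invr_gt0; lra. Qed.

Lemma jump_min_ge : 7 / 10 / h <= jump H (- (n * Db)).
Proof.
bounds.
have E : (7 / 10 / h)^-1 = 10 / 7 * h by field; apply: lt0r_neq0; lra.
have := jump_den H3 (- (n * Db)).
rewrite /jump opprK -[7 / 10 / h]invrK E => X0.
rewrite lef_pV2 ?posrE //; last by lra.
have := expR_nDeltabar_le; nra.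
Qed.

(** Here [w] is the number of wrong signs of an action. The three factors of [jump_sub] are at least
    7/(10h), 7/12 and 2hDw, and 49/60 >= 4/5. *)
Lemma jump_gap (w : R) : 0 <= w -> - (n * Db) <= n * Db - 2 * Db * w ->
  4 / 5 * D * w <= jump H (n * Db) - jump H (n * Db - 2 * Db * w).
Proof.
bounds.
move=> w0 wn; rewrite jump_sub //.
set x := n * Db - _.
have xp : 7 / 10 / h <= jump H x by apply: le_trans jump_min_ge _; apply: jump_le.
have E : 2 * Db * w <= expR (n * Db - x) - 1.
  have := expR_ge1Dx (n * Db - x); rewrite /x; lra.
have P : 7 / 12 <= 1 - jump H (n * Db).
  have := jump_max_le.
  have : h^-1 <= 3^-1 by rewrite lef_pV2 ?posrE; lra.
  lra.
have h0 : 0 < h^-1 by rewrite invr_gt0; lra.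
apply: le_trans (_ : (7 / 10 / h) * (7 / 12) * (2 * Db * w) <= _).
  apply: le_trans (_ : (7 / 10 / h) * (7 / 12) * (2 * (h * D) * w) <= _).
    have -> : 7 / 10 / h * (7 / 12) * (2 * (h * D) * w) = 49 / 60 * (D * w).
      by field; apply: lt0r_neq0; lra.
    have := mulr_ge0 (ltW Delta_gt0) w0; lra.
  apply: ler_wpM2l; first by lra.
  apply: ler_wpM2r => //; have := Deltabar_ge; lra.
have Dw : 0 <= 2 * Db * w by have := mulr_ge0 (ltW Deltabar_gt0) w0; lra.
have L : 7 / 10 / h * (7 / 12) <= jump H x * (1 - jump H (n * Db)).
  by apply: ler_pM => //; lra.
by apply: ler_pM => //; lra.
Qed.

(** A sign flip moves the score by [2 * Db]. The loss is at most 5/16 (204/49)^2 h D^2, and h D^2 =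
    1/(32K) by [Delta_sqr]. *)
Lemma jump_affinity_ge (x y : R) : x <= n * Db -> y - x = 2 * Db ->
  1 - 17 / 100 / k <=
  Num.sqrt (jump H y * jump H x) + Num.sqrt ((1 - jump H y) * (1 - jump H x)).
Proof.
bounds.
move=> xn yx; have Db0 := Deltabar_gt0.
apply: le_trans (jump_affinity H3 (_ : x <= y)); last by lra.
rewrite yx lerD2l lerN2.
have := expR_2Deltabar_le; set E := expR _ - 1 => EE.
have E0 : 0 <= E by have := expR_ge1Dx (2 * Db); rewrite /E; lra.
have j0 := jump_gt0 H3 x.
have j1 : jump H x <= 5 / 4 / h by apply: le_trans (jump_le H3 xn) jump_max_le.
apply: le_trans (_ : (5 / 4 / h) * (204 / 49 * (h * D)) ^+ 2 / 4 <= _).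
  apply: ler_wpM2r => //; apply: ler_pM => //; [exact: ltW|exact: sqr_ge0|].
  by apply: lerXn2r; rewrite ?nnegrE //; lra.
have k0 : 0 < k by have := horizon_episodes_gt0; rewrite pmulr_rgt0 //; lra.
rewrite ler_pdivlMr // -subr_ge0.
have -> : 17 / 100 - 5 / 4 / h * (204 / 49 * (h * D)) ^+ 2 / 4 * k =
   17 / 100 - 5 / 16 * (204 / 49) ^+ 2 / 32 * (32 * (h * k) * D ^+ 2).
  field; apply: lt0r_neq0; lra.
rewrite Delta_sqr; lra.
Qed.

(** By 1 - p >= exp(-p/(1 - p)) the power is at least exp(-5/4), the eighth power of exp(-5/32) >=
    27/32. *)
Lemma jump_max_survival m : (m <= H - 2)%N -> (27 / 32) ^+ 8 <= (1 - jump H (n * Db)) ^+ m.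
Proof.
bounds.
move=> mH; set p := jump H _.
have p1 : p <= 5 / 4 / h := jump_max_le.
have p0 : 0 < p := jump_gt0 H3 _.
have h3i : h^-1 <= 3^-1 by rewrite lef_pV2 ?posrE; lra.
have p2 : p < 1 by lra.
set x := p / (1 - p).
have x0 : 0 <= x by rewrite divr_ge0; lra.
have E : expR (- x) <= 1 - p.
  rewrite expRN -[1 - p]invrK lef_pV2 ?posrE ?expR_gt0 ?invr_gt0 //; last by lra.
  have -> : (1 - p)^-1 = 1 + x by rewrite /x; field; apply: lt0r_neq0; lra.
  exact: expR_ge1Dx.
apply: (@le_trans _ _ (expR (- x) ^+ m)); last first.
  by apply: lerXn2r; rewrite ?nnegrE ?expR_ge0 //; lra.
rewrite -expRM_natl.
apply: (@le_trans _ _ (expR (- (5 / 32)) ^+ 8)).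
  have := expR_ge1Dx (- (5 / 32) : R).
  by move=> ?; apply: lerXn2r; rewrite ?nnegrE ?expR_ge0 //; lra.
rewrite -expRM_natl ler_expR.
suff : m%:R * x <= 5 / 4 by lra.
have mh : m%:R <= h - 2 :> R.
  by rewrite -(natrB _ (_ : 2 <= H)%N) ?ler_nat // ltnW.
apply: le_trans (_ : (h - 2) * x <= _); first exact: ler_wpM2r.
rewrite /x mulrA ler_pdivrMr; last by lra.
have : p * h <= 5 / 4 by rewrite -ler_pdivlMr //; lra.
lra.
Qed.

End Scalars.

(** * The hard family *)

Section Survival.
Variable R : realType.

(* Expected number of the remaining m steps spent before the jump, when the
   jump probability at the h-th of them is [p h]. *)
Fixpoint surv m : ('I_m -> R) -> R :=
  match m with
  | 0 => fun _ => 0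
  | m.+1 => fun p => 1 + (1 - p ord0) * surv (family_tail p)
  end.

Lemma survS m (p : 'I_m.+1 -> R) : surv p = 1 + (1 - p ord0) * surv (family_tail p).
Proof. by []. Qed.

(** Unfolded, [surv p] is a sum of m + 1 products of at most m factors, each factor at least 1 -
    P. *)
Lemma surv_ge (P : R) m (p : 'I_m.+1 -> R) : 0 <= P -> P <= 1 -> (forall h, p h <= P) ->
  m.+1%:R * (1 - P) ^+ m <= surv p.
Proof.
move=> P0 P1; elim: m p => [|m IH] p pP; first by rewrite /= expr0 mulr1; lra.
rewrite survS; have := IH (family_tail p) (fun h => pP _).
move: (surv (family_tail p)) => S HS.
have q0 : 0 <= (1 - P) ^+ m by apply: exprn_ge0; lra.
have q1 : (1 - P) ^+ m.+1 <= 1 by apply: exprn_ile1; lra.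
have S0 : 0 <= S by apply: (le_trans _ HS); rewrite mulr_ge0.
have : (1 - P) * (m.+1%:R * (1 - P) ^+ m) <= (1 - p ord0) * S.
  apply: ler_pM => //; [lra|by rewrite mulr_ge0|by rewrite lerD2l lerN2].
have -> : (1 - P) * (m.+1%:R * (1 - P) ^+ m) = m.+1%:R * (1 - P) ^+ m.+1.
  by rewrite exprS mulrCA.
rewrite -[m.+2%:R]natr1 [(_ + 1) * _]mulrDl mul1r. lra.
Qed.

(** Replacing P by [p h] one step at a time, the difference at step h is multiplied by (1 - P)^h for
    reaching it and by the survival over the m - h - 1 steps left, bounded by [surv_ge]. The
    exponents add up to m - 2. *)
Lemma surv_gap (P : R) m (p : 'I_m -> R) : 0 <= P -> P <= 1 -> (forall h, p h <= P) ->
  (1 - P) ^+ (m - 2) * (\sum_(h < m) (m - h.+1)%:R * (P - p h)) <=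
  surv p - surv (fun _ : 'I_m => P).
Proof.
move=> P0 P1; elim: m p => [|[|m] IH] p pP.
- by rewrite big_ord0 mulr0 subrr.
- by rewrite big_ord1 mul0r mulr0 /= !mulr0 subrr.
have := IH (family_tail p) (fun h => pP _); have := surv_ge P0 P1 (fun h => pP (lift ord0 h)).
rewrite -/(family_tail p); set S := surv (family_tail p); set SP := surv (fun _ : 'I_m.+1 => P).
have -> : surv p - surv (fun _ : 'I_m.+2 => P) = (1 - P) * (S - SP) + (P - p ord0) * S.
  by rewrite survS [surv (fun _ : 'I_m.+2 => P)]survS -/S -/SP; ring.
move=> SS HS.
rewrite big_ord_recl mulrDr addrC; apply: lerD.
  apply: (le_trans _ (ler_wpM2l _ HS)); last by lra.
  (* For horizon 2 the truncated exponents do not match, but the only weight in the tail sum is then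
     0. *)
  rewrite mulrA -exprS; clearbody S SP; case: m p pP {IH SS HS} => [|m] p pP.
    by rewrite !big_ord1 /= mul0r !mulr0.
  by have -> : (m.+3 - 2 = (m.+2 - 2).+1)%N by rewrite !subSS !subn0.
have pP0 := pP ord0.
have : (P - p ord0) * (m.+1%:R * (1 - P) ^+ m) <= (P - p ord0) * S.
  by apply: ler_wpM2l => //; lra.
apply: le_trans; rewrite !subSS !subn0 le_eqVlt; apply/orP; left; apply/eqP; ring.
Qed.

Definition bonus H (i : St H) : R := (i == ord_max)%:R.

(** Both values go through one induction, as the Bellman equation at [inord k] involves the value at
    [ord_max]. A step pays 1 exactly after the jump, whence the number of steps minus [surv]. *)
Lemma path_reward_hard H m k (Q : 'I_m -> St H -> St H -> R) (p : 'I_m -> R) :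
  (k + m = H)%N ->
  (forall h x, \sum_y Q h x y = 1) ->
  (forall h f, \sum_y Q h ord_max y * f y = f ord_max) ->
  (forall (h : 'I_m) f, \sum_y Q h (inord (k + h)) y * f y =
     (1 - p h) * f (inord (k + h).+1) + p h * f ord_max) ->
  path_reward Q (@bonus H) (inord k) = m%:R - surv p /\
  path_reward Q (@bonus H) ord_max = m%:R.
Proof.
elim: m k Q p => [|m IH] k Q p km Q1 Qmax Qk.
  rewrite /path_reward; split; rewrite big1 ?subr0 // => tau _;
  by rewrite big_ord0 mulr0.
have [||||E1 E2] := IH k.+1 (family_tail Q) (family_tail p).
- by rewrite addSnnS.
- by move=> h x; apply: Q1.
- by move=> h f; apply: Qmax.
- by move=> h f; have := Qk (lift ord0 h) f; rewrite /= /bump leq0n add1n addnS addSn.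
rewrite !path_rewardS // Qmax E2 /bonus eqxx -natr1; split; last by rewrite addrC.
have := Qk ord0 (path_reward (family_tail Q) (@bonus H)); rewrite addn0 => ->.
rewrite E1 E2; have -> : (inord k == ord_max :> St H) = false.
  apply/negbTE/eqP => /(congr1 val) /=; rewrite inordK; last by rewrite -km !ltnS leqW // leq_addr.
  by move=> kH; have := leq_addr m.+1 k; rewrite km kH ltnn.
by rewrite survS /= mulr0n; ring.
Qed.

End Survival.

(** * Transitions, loss of a policy and effect of a sign flip *)

Section HardFamily.
Variables (R : realType) (d H K : nat).
Hypotheses (d2 : (2 <= d)%N) (H3 : (3 <= H)%N).
Hypothesis HK : Num.max ((d.-1)%:R ^+ 2 * H%:R / 2)
  (H%:R ^+ 3 * (d.-1)%:R ^+ 2 / 32) <= K%:R :> R.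

Local Notation n := ((d.-1)%:R : R).
Local Notation Db := (Deltabar R d H K).
Local Notation st := (St H).
Local Notation act := (Act d).
Local Notation prm := (param R d H).
Local Notation pol := (policy st act H).
Local Notation Tr := (@trans R d H K).

Let n1 : 1 <= n. Proof. by rewrite (ler_nat R 1); case: d d2 => [|[]]. Qed.
Let h3 : 3 <= H%:R :> R. Proof. by rewrite (ler_nat R 3 H). Qed.
Let Db0 : 0 < Db := Deltabar_gt0 d2 H3 HK.

Let den0 : 0 < 1 + n * Db.
Proof. by rewrite addr_gt0 // mulr_gt0 //; have ? := n1; lra. Qed.

Lemma alpha_sqr : alpha R d H K ^+ 2 = Db / (1 + n * Db).
Proof. by rewrite sqr_sqrtr // divr_ge0 // ltW. Qed.

Lemma beta_sqr : beta R d H K ^+ 2 = (1 + n * Db)^-1.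
Proof. by rewrite sqr_sqrtr // invr_ge0 // ltW. Qed.

Lemma alpha_gt0 : 0 < alpha R d H K.
Proof. by rewrite sqrtr_gt0 divr_gt0. Qed.

Lemma beta_gt0 : 0 < beta R d H K.
Proof. by rewrite sqrtr_gt0 invr_gt0. Qed.

Lemma unlift_widen (m : nat) (c : 'I_m) :
  unlift ord_max (widen_ord (leqnSn m) c) = Some c.
Proof.
have -> : widen_ord (leqnSn m) c = lift ord_max c by apply/val_inj; rewrite /= /bump leqNgt ltn_ord.
exact: liftK.
Qed.

Definition score (theta : prm) (h : 'I_H) (a : act) : R :=
  \sum_(c < d.-1) sgn R (a c) * theta h c.

(** The scalings alpha and beta cancel between feature and core. *)
Lemma dotv_feature_next (theta : prm) h (i j : st) a : (i < H)%N -> nat_of_ord j = i.+1 ->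
  dotv (feature R K i a j) (core K theta h) = - score theta h a + ln (H%:R - 1).
Proof.
move=> iH ji; rewrite /dotv big_ord_recr /= /feature /core iH ji eqxx /= unlift_none.
have := beta_gt0; have := alpha_gt0; move=> /lt0r_neq0 a0 /lt0r_neq0 b0.
congr (_ + _); last by field.
rewrite /score -sumrN; apply: eq_bigr => c _; rewrite unlift_widen.
by field.
Qed.

Lemma dotv_feature_max (theta : prm) h (i : st) a : (i < H)%N ->
  dotv (feature R K i a ord_max) (core K theta h) = 0.
Proof.
move=> iH; rewrite /dotv big1 // => c _.
by rewrite /feature iH /= eqSS gtn_eqF ?mul0r.
Qed.

Lemma transE (theta : prm) h (i : st) a (j : st) :
  Tr theta h i a j =
  if (i < H)%N then
    (if nat_of_ord j == i.+1 then 1 - jump H (score theta h a)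
     else if j == ord_max then jump H (score theta h a) else 0)
  else (j == i)%:R.
Proof.
rewrite /trans; case: ifP => // iH.
have hh := h3.
have E : expR (- score theta h a + ln (H%:R - 1)) = (H%:R - 1) * expR (- score theta h a).
  by rewrite expRD lnK ?posrE; [rewrite mulrC|lra].
have iS : nat_of_ord (inord i.+1 : st) = i.+1 by rewrite inordK // !ltnS ltnW.
rewrite (dotv_feature_next theta h a iH iS) (dotv_feature_max theta h a iH) expR0 E.
rewrite /jump; have D0 := jump_den H3 (score theta h a : R).
have [ji|ji] := eqVneq (nat_of_ord j) i.+1.
  rewrite /= (dotv_feature_next theta h a iH ji) E.
  by field; rewrite !lt0r_neq0 // addrC.
have [->|//] := eqVneq j ord_max.
by rewrite (dotv_feature_max theta h a iH) expR0 mul1r addrC.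
Qed.

Lemma sum_two_states (i : st) (F : st -> R) : (i < H)%N ->
  (forall j : st, nat_of_ord j != i.+1 -> j != ord_max -> F j = 0) ->
  \sum_j F j = F (inord i.+1) + F ord_max.
Proof.
move=> iH F0; have iS : nat_of_ord (inord i.+1 : st) = i.+1 by rewrite inordK // !ltnS ltnW.
rewrite (bigD1 (inord i.+1)) //= (bigD1 ord_max) /=; last first.
  by apply/eqP => /(congr1 val) /=; rewrite iS => -[E]; move: iH; rewrite -E ltnn.
rewrite big1 ?addr0 // => j /andP[j1 j2]; apply: F0 => //.
by apply: contra j1 => /eqP E; apply/eqP/val_inj; rewrite /= E iS.
Qed.

Lemma trans_next (theta : prm) h (i : st) a : (i < H)%N ->
  Tr theta h i a (inord i.+1) = 1 - jump H (score theta h a).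
Proof. by move=> iH; rewrite transE iH inordK ?eqxx // !ltnS ltnW. Qed.

Lemma trans_max (theta : prm) h (i : st) a : (i < H)%N ->
  Tr theta h i a ord_max = jump H (score theta h a).
Proof. by move=> iH; rewrite transE iH /= eqSS gtn_eqF // eqxx. Qed.

Lemma trans_other (theta : prm) h (i : st) a (j : st) : (i < H)%N ->
  nat_of_ord j != i.+1 -> j != ord_max -> Tr theta h i a j = 0.
Proof. by move=> iH ji jm; rewrite transE iH (negbTE ji) (negbTE jm). Qed.

Lemma trans_stay (theta : prm) h (i : st) a (j : st) : (H <= i)%N ->
  Tr theta h i a j = (j == i)%:R.
Proof. by move=> iH; rewrite transE ltnNge iH. Qed.

Lemma sum_trans (theta : prm) h (i : st) a (f : st -> R) : (i < H)%N ->
  \sum_j Tr theta h i a j * f j =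
  (1 - jump H (score theta h a)) * f (inord i.+1) + jump H (score theta h a) * f ord_max.
Proof.
move=> iH; rewrite (sum_two_states iH) ?trans_next ?trans_max // => j ji jm.
by rewrite trans_other // mul0r.
Qed.

Lemma sum_trans_stay (theta : prm) h (i : st) a (f : st -> R) : (H <= i)%N ->
  \sum_j Tr theta h i a j * f j = f i.
Proof.
move=> iH; rewrite (bigD1 i) //= trans_stay // eqxx mul1r big1 ?addr0 // => j ji.
by rewrite trans_stay // (negbTE ji) mul0r.
Qed.

Lemma trans_mass (theta : prm) h (i : st) a : \sum_j Tr theta h i a j = 1.
Proof.
under eq_bigr do rewrite -[Tr _ _ _ _ _]mulr1.
have [iH|iH] := ltnP i H; last by rewrite (@sum_trans_stay theta h i a (fun _ => 1)).
by rewrite (@sum_trans theta h i a (fun _ => 1)) // !mulr1 subrK.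
Qed.

Lemma trans_ge0 (theta : prm) h (i : st) a j : 0 <= Tr theta h i a j.
Proof.
rewrite transE; have := jump_gt0 H3 (score theta h a); have := jump_lt1 H3 (score theta h a).
by move=> ? ?; do !case: ifP => // _; lra.
Qed.

Lemma traj_prob_ge0 (theta : prm) pi tau : 0 <= traj_prob (Tr theta) (x1 H) pi tau.
Proof.
rewrite mulr_ge0 // prodr_ge0 // => h _; exact: trans_ge0.
Qed.

Lemma traj_prob_mass (theta : prm) pi : \sum_tau traj_prob (Tr theta) (x1 H) pi tau = 1.
Proof.
apply: (@mass_path_weight R st H (fun h x y => Tr theta h x (pi h x) y)) => h x.
exact: trans_mass.
Qed.

(** Before the jump the state at step h is [inord h], so only the action prescribed there affects
    the value. *)
Definition jumps (theta : prm) (pi : pol) (h : 'I_H) : R :=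
  jump H (score theta h (pi h (inord h))).

Lemma value_surv (theta : prm) (pi : pol) :
  value (Tr theta) (@reward R d H) (x1 H) pi = H%:R - surv (jumps theta pi).
Proof.
have [||||E _] := @path_reward_hard R H H 0 (fun h x y => Tr theta h x (pi h x) y) (jumps theta pi).
- by [].
- by move=> h x; apply: trans_mass.
- by move=> h f; apply: sum_trans_stay; rewrite /= leqnSn.
- move=> h f; rewrite add0n; have hH := ltn_ord h.
  have iE : nat_of_ord (inord h : st) = h by rewrite inordK // ltnW // ltnW.
  by rewrite sum_trans iE.
rewrite -E; have -> : inord 0 = x1 H by apply/val_inj; rewrite /= inordK.
by [].
Qed.

(** Indexing by booleans makes the sign vectors a finite type, to average over. *)
Definition signed (b : {ffun 'I_H -> act}) : prm := fun h c => Db * sgn R (b h c).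

Definition misses (b : {ffun 'I_H -> act}) (h : 'I_H) (a : act) : R :=
  \sum_(c < d.-1) (a c != b h c)%:R.

Lemma score_signed b h a :
  score (signed b) h a = n * Db - 2 * Db * misses b h a.
Proof.
rewrite /score /misses mulr_sumr.
have -> : n * Db = \sum_(c < d.-1) Db by rewrite sumr_const card_ord mulr_natl.
rewrite -sumrB; apply: eq_bigr => c _; rewrite /signed /sgn.
by case: (a c) (b h c) => [] [] /=; ring.
Qed.

Lemma misses_ge0 b h a : 0 <= misses b h a.
Proof. by apply: sumr_ge0. Qed.

Lemma misses_le b h a : misses b h a <= n.
Proof.
have -> : n = \sum_(c < d.-1) 1 by rewrite sumr_const card_ord.
by apply: ler_sum => c _; case: (_ != _).
Qed.

Lemma misses_eq0 b h : misses b h (b h) = 0.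
Proof. by apply: big1 => c _; rewrite eqxx. Qed.

Lemma regret_gap b (pi : pol) :
  (27 / 32) ^+ 8 * (4 / 5 * Delta R H K) *
     (\sum_(h < H) (H - h.+1)%:R * misses b h (pi h (inord h))) <=
  opt_value (Tr (signed b)) (@reward R d H) (x1 H) -
    value (Tr (signed b)) (@reward R d H) (x1 H) pi.
Proof.
set P := jump H (n * Db).
have P0 : 0 < P := jump_gt0 H3 _.
have P1 : P < 1 := jump_lt1 H3 _.
(* This policy matches every sign, so it jumps with probability P at each step; its value bounds
   [opt_value] from below. *)
pose best : pol := [ffun h => [ffun _ => b h]].
have Ebest : value (Tr (signed b)) (@reward R d H) (x1 H) best = H%:R - surv (fun _ : 'I_H => P).
  rewrite value_surv; congr (_ - surv _); apply/funext => h.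
  by rewrite /jumps !ffunE score_signed misses_eq0 mulr0 subr0.
have le_opt := le_bigmax (0 : R) (value (Tr (signed b)) (@reward R d H) (x1 H)) best.
apply: (@le_trans _ _ (surv (jumps (signed b) pi) - surv (fun _ : 'I_H => P))); last first.
  by rewrite (value_surv _ pi); move: le_opt; rewrite Ebest /opt_value; lra.
have gap h : 4 / 5 * Delta R H K * misses b h (pi h (inord h)) <= P - jumps (signed b) pi h.
  rewrite /jumps score_signed; apply: jump_gap => //; first exact: misses_ge0.
  have := misses_le b h (pi h (inord h)); have := Db0; move=> ? ?; nra.
have D0 := Delta_gt0 d2 H3 HK.
have gap0 h : jumps (signed b) pi h <= P.
  rewrite -subr_ge0; apply: le_trans (gap h).
  by rewrite !mulr_ge0 ?misses_ge0 //; lra.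
apply: le_trans (surv_gap (ltW P0) (ltW P1) gap0).
rewrite -mulrA; apply: ler_pM.
- by rewrite exprn_ge0 //; lra.
- rewrite mulr_ge0 ?mulr_ge0 //; try lra.
  by apply: sumr_ge0 => h _; rewrite mulr_ge0 ?misses_ge0.
- exact: jump_max_survival.
rewrite mulr_sumr; apply: ler_sum => h _; rewrite mulrCA.
exact: ler_wpM2l.
Qed.

Definition flip (h0 : 'I_H) (c0 : 'I_(d.-1)) (b : {ffun 'I_H -> act}) : {ffun 'I_H -> act} :=
  [ffun h => [ffun c => (b h c) (+) ((h == h0) && (c == c0))]].

Lemma flipK h0 c0 : involutive (flip h0 c0).
Proof.
by move=> b; apply/ffunP => h; apply/ffunP => c; rewrite !ffunE -addbA addbb addbF.
Qed.

Lemma score_flip_other h0 c0 b h a : h != h0 ->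
  score (signed (flip h0 c0 b)) h a = score (signed b) h a.
Proof.
by move=> hh; apply: eq_bigr => c _; rewrite /signed !ffunE (negbTE hh) addbF.
Qed.

Lemma score_flip h0 c0 b a :
  score (signed (flip h0 c0 b)) h0 a =
  score (signed b) h0 a - 2 * (sgn R (a c0) * signed b h0 c0).
Proof.
rewrite /score (bigD1 c0) //= [in RHS](bigD1 c0) //=.
have -> : signed (flip h0 c0 b) h0 c0 = - signed b h0 c0.
  by rewrite /signed !ffunE !eqxx /sgn; case: (b h0 c0) => /=; ring.
rewrite (eq_bigr (fun c => sgn R (a c) * signed b h0 c)); first by ring.
by move=> c cc; rewrite /signed !ffunE (negbTE cc) andbF addbF.
Qed.

Lemma score_le b h a : score (signed b) h a <= n * Db.
Proof.
rewrite score_signed; have := misses_ge0 b h a; have := Db0; move=> ? ?.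
by rewrite gerBl mulr_ge0 // mulr_ge0 // ltW.
Qed.

Lemma jump_affinity_flip h0 c0 b a :
  let j := jump H (score (signed b) h0 a) in
  let j' := jump H (score (signed (flip h0 c0 b)) h0 a) in
  1 - 17 / 100 / K%:R <= Num.sqrt (j * j') + Num.sqrt ((1 - j) * (1 - j')).
Proof.
move=> /=; have E := score_flip h0 c0 b a.
have := score_le b h0 a; have := score_le (flip h0 c0 b) h0 a.
move: E; rewrite [signed b h0 c0]/signed; move: (score _ _ _) (score _ _ _) => x y E yn xn.
(* The order of the two scores depends on whether the action agrees with [b] at the flipped
   coordinate. *)
have [L|L] : (x - y = 2 * Db) \/ (y - x = 2 * Db).
  move: E; rewrite /sgn; case: (a c0) (b h0 c0) => [] [] ->; [left|right|right|left]; ring.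
- exact: (@jump_affinity_ge R d H K).
- rewrite [jump H x * _]mulrC [(1 - jump H x) * _]mulrC.
  exact: (@jump_affinity_ge R d H K).
Qed.

Lemma episodes_ge1 : 1 <= K%:R :> R.
Proof.
have := horizon_episodes_gt0 d2 H3 HK; case: K => [|k]; first by rewrite mulr0 ltxx.
by rewrite (ler_nat R 1).
Qed.

(** From an absorbing state the two laws coincide and the affinity is 1, which is where [c <= 1]
    enters. *)
Lemma trans_affinity (theta theta' : prm) h (i : st) a (c : R) : c <= 1 ->
  let j := jump H (score theta h a) in
  let j' := jump H (score theta' h a) in
  c <= Num.sqrt (j * j') + Num.sqrt ((1 - j) * (1 - j')) ->
  c <= \sum_y Num.sqrt (Tr theta h i a y * Tr theta' h i a y).
Proof.
move=> c1 j j' cj; have [iH|iH] := ltnP i H.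
  rewrite (sum_two_states iH) => [|y y1 y2]; last by rewrite trans_other // mul0r sqrtr0.
  by rewrite !trans_next // !trans_max // addrC.
rewrite (bigD1 i) //= !trans_stay // eqxx mulr1 sqrtr1.
by apply: (le_trans c1); rewrite lerDl; apply: sumr_ge0 => y _; apply: sqrtr_ge0.
Qed.

Lemma sqrt_self (x : R) : 0 <= x -> Num.sqrt (x * x) = x.
Proof. by move=> x0; rewrite -expr2 sqrtr_sqr ger0_norm. Qed.

(** The two chains differ only at step [h0], so a single factor of the product over steps is below
    1. *)
Lemma traj_affinity h0 c0 b (pi : pol) :
  1 - 17 / 100 / K%:R <= \sum_tau
    Num.sqrt (traj_prob (Tr (signed b)) (x1 H) pi tau *
              traj_prob (Tr (signed (flip h0 c0 b))) (x1 H) pi tau).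
Proof.
set eps := 17 / 100 / K%:R.
have K1 := episodes_ge1.
have e0 : 0 <= eps by rewrite divr_ge0 //; lra.
have e1 : eps <= 1 by rewrite ler_pdivrMr; lra.
pose Q (h : 'I_H) (x y : st) :=
  Num.sqrt (Tr (signed b) h x (pi h x) y * Tr (signed (flip h0 c0 b)) h x (pi h x) y).
have -> : 1 - eps = \prod_(h < H) (if h == h0 then 1 - eps else 1).
  by rewrite -big_mkcond big_pred1_eq.
rewrite [leRHS](eq_bigr (path_weight Q (x1 H))); last first.
  move=> tau _; rewrite /traj_prob /path_weight.
  case: (_ == _); last by rewrite !mul0r sqrtr0.
  rewrite !mul1r -big_split /= -[RHS]sqrt_self; last by apply: prodr_ge0 => h _; apply: sqrtr_ge0.
  congr Num.sqrt; rewrite -big_split; apply: eq_bigr => h _ /=.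
  by rewrite /Q -expr2 sqr_sqrtr // mulr_ge0 // trans_ge0.
apply: mass_path_weight_ge.
- by move=> h x y; apply: sqrtr_ge0.
- by move=> h; case: ifP => // _; lra.
- move=> h x; case: eqP => [->|/eqP hh]; apply: trans_affinity => //; first by lra.
    exact: jump_affinity_flip.
  rewrite score_flip_other //; set j := jump H _.
  have j0 : 0 < j := jump_gt0 H3 _; have j1 : j < 1 := jump_lt1 H3 _.
  by rewrite !sqrt_self; lra.
Qed.

(** Bernoulli's inequality gives (1 - 17/(100K))^K >= 83/100, and 33/100 is left after subtracting
    1/2. *)
Lemma hist_overlap (alg : algorithm R st act H) h0 c0 b : valid_alg alg ->
  33 / 100 <= \sum_(hs : K.-tuple (pol * traj st H))
    Num.min (hist_prob (Tr (signed b)) (x1 H) alg hs)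
            (hist_prob (Tr (signed (flip h0 c0 b))) (x1 H) alg hs).
Proof.
move=> va; have K1 := episodes_ge1.
have e1 : 17 / 100 / K%:R <= 1 :> R by rewrite ler_pdivrMr; lra.
apply: (le_trans _ (sum_min_hist_weight va K _ _ _ _ _ (traj_affinity h0 c0 b))).
- have := @bernoulli_ineq R (- (17 / 100 / K%:R)) K ltac:(lra).
  have -> : K%:R * - (17 / 100 / K%:R) = - (17 / 100) :> R.
    by field; apply: lt0r_neq0; lra.
  lra.
- by move=> *; apply: traj_prob_ge0.
- by move=> *; apply: traj_prob_ge0.
- by move=> *; apply: traj_prob_mass.
- by move=> *; apply: traj_prob_mass.
- lra.
Qed.

End HardFamily.

(** * Norms of cores and features *)

Section Norms.
Variables (R : realType) (d H K : nat).
Hypotheses (d2 : (2 <= d)%N) (H3 : (3 <= H)%N).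
Hypothesis HK : Num.max ((d.-1)%:R ^+ 2 * H%:R / 2)
  (H%:R ^+ 3 * (d.-1)%:R ^+ 2 / 32) <= K%:R :> R.

Local Notation n := ((d.-1)%:R : R).
Local Notation Db := (Deltabar R d H K).
Let Db0 : 0 < Db := Deltabar_gt0 d2 H3 HK.

(** The squared norm is n Db (1 + n Db) + (1 + n Db), a perfect square. *)
Lemma norm2_core_signed b h : norm2 (core K (@signed R d H K b) h) = 1 + n * Db.
Proof.
have D0 := Db0.
have nD : 0 <= n * Db by rewrite mulr_ge0 // ltW.
have a2 := alpha_sqr d2 H3 HK; have b2 := beta_sqr d2 H3 HK.
rewrite -[RHS]ger0_norm; last by rewrite addr_ge0.
rewrite -sqrtr_sqr /norm2; congr Num.sqrt.
rewrite big_ord_recr /= /core unlift_none exprVn b2 invrK.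
rewrite (eq_bigr (fun _ => Db * (1 + n * Db))); last first.
  move=> c _; rewrite unlift_widen expr_div_n a2 /signed.
  have -> : (Db * sgn R (b h c)) ^+ 2 = Db ^+ 2.
    by rewrite /sgn; case: (b h c); ring.
  move: nD D0; move: Db n => x y ? ?; field.
  by rewrite !lt0r_neq0 //; lra.
rewrite sumr_const card_ord -[_ *+ d.-1]mulr_natl; ring.
Qed.

Lemma Ltheta_signed_le b : Ltheta K (@signed R d H K b) <= 3 / 2.
Proof.
apply: bigmax_le => [|h _]; first by lra.
rewrite norm2_core_signed; have := nDeltabar_le d2 H3 HK; lra.
Qed.

Lemma norm2_feature_le i a j : norm2 (@feature R d H K i a j) <= 1 + ln (H%:R - 1).
Proof.
have D0 := Db0; have a2 := alpha_sqr d2 H3 HK; have b2 := beta_sqr d2 H3 HK.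
have h3 : (3%:R : R) <= H%:R by rewrite ler_nat.
have nD : 0 <= n * Db by rewrite mulr_ge0 // ltW.
have L0 : 0 <= ln (H%:R - 1) :> R by apply: ln_ge0; lra.
have L1 : 0 <= 1 + ln (H%:R - 1) :> R by rewrite addr_ge0.
rewrite /norm2 /feature; case: (_ && _); last first.
  by rewrite big1 ?sqrtr0 // => c _; rewrite expr0n.
rewrite -[leRHS]ger0_norm // -sqrtr_sqr; apply: ler_wsqrtr.
rewrite big_ord_recr /= unlift_none.
rewrite (eq_bigr (fun _ => Db / (1 + n * Db))); last first.
  move=> c _; rewrite unlift_widen -a2 /sgn; case: (a c); ring.
rewrite sumr_const card_ord -[_ *+ d.-1]mulr_natl exprMn b2.
move: (ln _) L0 {L1} => L L0; move: nD; set x := n * Db => x0.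
rewrite mulrA -/x (mulrC _^-1) -mulrDl ler_pdivrMr; last by lra.
have := mulr_ge0 x0 (sqr_ge0 L); have := mulr_ge0 x0 L0; nra.
Qed.

Lemma Lphi_le : Lphi R d H K <= 1 + ln (H%:R - 1).
Proof.
have h3 : (3%:R : R) <= H%:R by rewrite ler_nat.
apply: bigmax_le => [|t _]; last exact: norm2_feature_le.
by rewrite addr_ge0 // ln_ge0 //; lra.
Qed.

End Norms.

(** * Averaging the regret over all sign vectors *)

Section Averaging.
Variables (R : realType) (d H K : nat).
Hypotheses (d2 : (2 <= d)%N) (H3 : (3 <= H)%N).
Hypothesis HK : Num.max ((d.-1)%:R ^+ 2 * H%:R / 2)
  (H%:R ^+ 3 * (d.-1)%:R ^+ 2 / 32) <= K%:R :> R.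
Local Notation n := ((d.-1)%:R : R).
Local Notation pol := (policy (St H) (Act d) H).
Local Notation signs := {ffun 'I_H -> Act d}.
Variable alg : algorithm R (St H) (Act d) H.
Hypothesis alg_valid : valid_alg alg.
Local Notation hist := (K.-tuple (pol * traj (St H) H)).

Definition hprob (b : signs) (hs : hist) : R :=
  hist_prob (@trans R d H K (@signed R d H K b)) (x1 H) alg hs.

Definition ereg (b : signs) : R :=
  expected_regret (@trans R d H K (@signed R d H K b)) (@reward R d H) (x1 H) K alg.

Definition miss (b : signs) (h : 'I_H) (c : 'I_(d.-1)) (k : 'I_K) (hs : hist) : R :=
  ((tnth hs k).1 h (inord h) c != b h c)%:R.

Lemma hprob_ge0 b hs : 0 <= hprob b hs.
Proof. by apply: hist_weight_ge0 => // *; apply: traj_prob_ge0. Qed.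

Lemma ereg_ge b :
  (27 / 32) ^+ 8 * (4 / 5 * Delta R H K) *
    (\sum_(h < H) (H - h.+1)%:R *
       \sum_(c < d.-1) \sum_(k < K) \sum_hs hprob b hs * miss b h c k hs) <= ereg b.
Proof.
set C := _ * (4 / 5 * _).
pose G (hs : hist) := \sum_(k < K) \sum_(h < H) (H - h.+1)%:R *
    misses R b h ((tnth hs k).1 h (inord h)).
apply: (@le_trans _ _ (\sum_hs hprob b hs * (C * G hs))); last first.
  apply: ler_sum => hs _; apply: ler_wpM2l; first exact: hprob_ge0.
  by rewrite /G mulr_sumr; apply: ler_sum => k _; apply: regret_gap.
rewrite le_eqVlt; apply/orP; left; apply/eqP.
under [RHS]eq_bigr do rewrite mulrCA.
rewrite -mulr_sumr; congr (_ * _); rewrite /G.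
under [RHS]eq_bigr do rewrite mulr_sumr.
rewrite [RHS]exchange_big /=.
under [RHS]eq_bigr do under eq_bigr do rewrite mulr_sumr.
under [RHS]eq_bigr do rewrite exchange_big /=.
rewrite [RHS]exchange_big /=; apply: eq_bigr => h _.
rewrite exchange_big mulr_sumr; apply: eq_bigr => k _.
rewrite exchange_big mulr_sumr; apply: eq_bigr => hs _.
by rewrite mulrCA -mulr_sumr.
Qed.

(** Assouad's argument: each [b] is paired with its flip at (h, c). The sign played is wrong for
    exactly one of the two, so their errors together are at least the overlap 33/100, and half of it
    on average. *)
Lemma sum_miss_ge h c k :
  33 / 200 * #|{: signs}|%:R <= \sum_b \sum_hs hprob b hs * miss b h c k hs.
Proof.
set X := fun b => \sum_hs hprob b hs * miss b h c k hs.
have E : \sum_b X b = \sum_b X (flip h c b).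
  by rewrite (reindex_inj (inv_inj (flipK h c))).
suff : \sum_(b : signs) (33 / 100 : R) <= \sum_b (X b + X (flip h c b)).
  by rewrite big_split /= -E sumr_const -mulr_natr; lra.
apply: ler_sum => b _; apply: le_trans (hist_overlap d2 H3 HK h c b alg_valid) _.
rewrite /X -big_split; apply: ler_sum => hs _ /=.
rewrite -!/(hprob _ hs) /miss.
have -> : flip h c b h c = ~~ b h c by rewrite !ffunE !eqxx addbT.
by case: ((tnth hs k).1 h (inord h) c) (b h c) => [] [] /=;
  rewrite ?mulr1 ?mulr0 ?addr0 ?add0r ge_min lexx ?orbT.
Qed.

Lemma sum_remaining_steps m : \sum_(h < m) (m - h.+1)%:R = m%:R * (m%:R - 1) / 2 :> R.
Proof.
elim: m => [|m IH]; first by rewrite big_ord0 !mul0r.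
rewrite big_ord_recl subn1 /=.
rewrite (eq_bigr (fun h : 'I_m => (m - h.+1)%:R)) ?IH; last by [].
by rewrite -natr1; field.
Qed.

(** A maximizer of the expected regret does at least as well as the average over all sign
    vectors. *)
Lemma exists_ereg_ge : exists b,
  (27 / 32) ^+ 8 * (4 / 5 * Delta R H K) * (33 / 200 * K%:R * n * (H%:R * (H%:R - 1) / 2))
    <= ereg b.
Proof.
pose b0 : signs := [ffun _ => [ffun _ => true]].
have [b _ bmax] := @Order.TotalTheory.arg_maxP _ _ _ b0 predT ereg isT.
exists b.
have B0 : 0 < #|{: signs}|%:R :> R by rewrite ltr0n; apply/card_gt0P; exists b0.
rewrite -(ler_pM2l B0).
apply: (@le_trans _ _ (\sum_b ereg b)); last first.
  by rewrite mulr_natl -sumr_const; apply: ler_sum => b' _; apply: bmax.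
apply: le_trans (ler_sum _ (fun b _ => ereg_ge b)).
set C := _ * (4 / 5 * _).
have C0 : 0 <= C by have := Delta_gt0 d2 H3 HK; move=> ?; rewrite !mulr_ge0 ?exprn_ge0 //; lra.
rewrite -mulr_sumr mulrCA; apply: ler_wpM2l => //.
rewrite exchange_big -sum_remaining_steps mulrA mulr_sumr /=.
apply: ler_sum => h _; rewrite -mulr_sumr mulrC; apply: ler_wpM2l => //.
rewrite exchange_big /=.
have -> : #|{: signs}|%:R * (33 / 200 * K%:R * n) =
    \sum_(c < d.-1) \sum_(k < K) (33 / 200 * #|{: signs}|%:R) :> R.
  rewrite !sumr_const !card_ord.
  by rewrite -[_ *+ K]mulr_natr -[_ *+ d.-1]mulr_natr; ring.
apply: ler_sum => c _; rewrite exchange_big; apply: ler_sum => k _.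
exact: sum_miss_ge.
Qed.

End Averaging.

Theorem theorem8 (R : realType) (d H K : nat) :
  (2 <= d)%N -> (3 <= H)%N ->
  Num.max ((d.-1)%:R ^+ 2 * H%:R / 2) (H%:R ^+ 3 * (d.-1)%:R ^+ 2 / 32) <= K%:R :> R ->
  forall alg : algorithm R (St H) (Act d) H,
    valid_alg alg ->
    exists theta : param R d H,
      (forall h i, theta h i = Deltabar R d H K \/ theta h i = - Deltabar R d H K) /\
      @Ltheta R d H K theta <= 3 / 2 /\
      Lphi R d H K <= 1 + ln (H%:R - 1) /\
      (d.-1)%:R * Num.sqrt (H%:R ^+ 3) * Num.sqrt K%:R / (480 * Num.sqrt 2)
        <= @expected_regret R (St H) (Act d) H (@trans R d H K theta) (@reward R d H) (x1 H) K alg.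
Proof.
move=> d2 H3 HK alg va.
have [b reg_b] := exists_ereg_ge d2 H3 HK va.
exists (@signed R d H K b); split; last split; last split.
- by move=> h i; rewrite /signed /sgn; case: (b h i); [left|right]; rewrite ?mulrN mulr1.
- exact: Ltheta_signed_le.
- exact: Lphi_le.
apply: le_trans reg_b.
have h3 : (3%:R : R) <= H%:R by rewrite ler_nat.
have K1 := episodes_ge1 d2 H3 HK.
have u0 : 0 < Num.sqrt (2 : R) by rewrite sqrtr_gt0.
have v0 : 0 < Num.sqrt (H%:R : R) by rewrite sqrtr_gt0; lra.
have w0 : 0 < Num.sqrt (K%:R : R) by rewrite sqrtr_gt0; lra.
have v2 : Num.sqrt (H%:R : R) ^+ 2 = H%:R by rewrite sqr_sqrtr.
have w2 : Num.sqrt (K%:R : R) ^+ 2 = K%:R by rewrite sqr_sqrtr.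
have -> : Num.sqrt (H%:R ^+ 3 : R) = H%:R * Num.sqrt H%:R.
  by rewrite exprSr sqrtrM ?exprn_ge0 // sqrtr_sqr ger0_norm.
rewrite /Delta sqrtrM ?mulr_ge0 // sqrtrM // -[X in 33 / 200 * X]w2 -[X in X * (H%:R - 1)]v2.
move: (Num.sqrt (2 : R)) (Num.sqrt (H%:R : R)) (Num.sqrt (K%:R : R)) u0 v0 w0 {v2 w2}
  => u v w u0 v0 w0.
set m := (d.-1)%:R.
(* Both sides become multiples of m v w / u, where u, v, w stand for the square roots of 2, H and
   K. *)
have -> : (27 / 32) ^+ 8 * (4 / 5 * (4 * (u * v * w))^-1) *
    (33 / 200 * w ^+ 2 * m * (v ^+ 2 * (H%:R - 1) / 2)) =
    m * v * w / u * ((27 / 32) ^+ 8 * (4 / 5) / 4 * (33 / 200) * ((H%:R - 1) / 2)).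
  by field; rewrite !lt0r_neq0.
have -> : m * (H%:R * v) * w / (480 * u) = m * v * w / u * (H%:R / 480).
  by field; rewrite !lt0r_neq0.
apply: ler_wpM2l; first by rewrite divr_ge0 ?mulr_ge0 // ltW.
(* Since H >= 3, (H - 1)/2 >= H/3, and the product of the other constants exceeds 1/160. *)
lra.
Qed.
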